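(* Let $G$ be a (connected) ribbon graph cellularly embedded in a closed orientable surface $\Sigma$, with a fixed reference orientation. Let $\bar\varphi: Jac(\mathcal{C}(G,\Sigma))\to S(G^{\bowtie})$ be the group isomorphism induced by the linear map $\varphi:\mathbb{Z}^{E(G)}\to\mathbb{Z}^{E(G)}_0$, $\varphi(\mathbf{1}_e)=-\chi_{{\rm med}^+(e)}$. Then the canonical Bernardi action $\Gamma$ of $Jac(\mathcal{C}(G,\Sigma))$ on spanning quasi-trees of $G$ agrees with the tour-rotor action of $S(G^{\bowtie})$ transported via Bouchet's bijection: for every $\mathbf{v}\in Jac(\mathcal{C}(G,\Sigma))$ and every spanning quasi-tree $Q$, if $\mathcal{E}_Q$ denotes the Eulerian tour of $G^{\bowtie}$ corresponding to $Q$, then $r(\bar\varphi(\mathbf{v}),\mathcal{E}_Q)=\mathcal{E}_{\Gamma(\mathbf{v},Q)}$.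
   Context: Setting. $G^*$ is the dual of $G$ in $\Sigma$; $e$ and $e^*$ cross at $v_e$. Orient $e^*$ by rotating the reference orientation of $e$ positively. ${\rm primal}^\pm(e)$ is the half of $e$ (on either side of $v_e$) containing the head/tail of $e$; ${\rm dual}^\pm(e)$ is the half of $e^*$ containing the head/tail of $e^*$. A spanning quasi-tree is a spanning subgraph whose neighbourhood in $\Sigma$ has one boundary component. Medial digraph $G^{\bowtie}$: nodes $v_e$, and for each vertex $v$ and end of $e$ at $v$ an arc $v_e\to v_f$, $f$'s end following $e$'s end at $v$; around $v_e$ in positive order: half of $e$, in-arc, half of $e^*$, out-arc, half of $e$, in-arc, half of $e^*$, out-arc. ${\rm med}^-(e)$ is the out-arc of $v_e$ between ${\rm dual}^-(e)$ and ${\rm primal}^+(e)$; ${\rm med}^+(e)$ the out-arc between ${\rm dual}^+(e)$ and ${\rm primal}^-(e)$. For an arc $f$ from $a$ to $b$, $\chi_f=\mathbf{1}_b-\mathbf{1}_a$. $S(G^{\bowtie})=\mathbb{Z}^{E}_0/\sim$ (zero-sum vectors on nodes modulo firings). Each passage of an Eulerian tour through $v_e$ goes from an in-arc to the next-but-one... i.e. to an out-arc and crosses the half-edge lying between them (of $e$ or of $e^*$); a tour crosses either both halves of $e$ or both halves of $e^*$. Bouchet's bijection sends a tour to $Q=\{e:$ the tour does not cross $e\}$, a bijection onto spanning quasi-trees; $\mathcal{E}_Q$ is its inverse. Tour-rotor action: every Eulerian tour of $G^{\bowtie}$ is compatible (out-degrees are 2). For an arc $\overrightarrow{ab}$, $A_{\overrightarrow{ab}}(\mathcal{E})$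 is the in-arborescence rooted at $a$ of last-traversed out-arcs when $\mathcal{E}$ starts with $\overrightarrow{ab}$. A routing at a node on $(x,\varrho)$ ($\varrho$ a choice of out-arc per node) switches its rotor to its other out-arc and moves one chip from the node to that arc's head; $\sim$ on such pairs is reachability by routings. $r(x,\mathcal{E})=\mathcal{E}'$ iff $(x,A_{\overrightarrow{ab}}(\mathcal{E})\cup\{\overrightarrow{ab}\})\sim(\mathbf{0},A_{\overrightarrow{ab}}(\mathcal{E}')\cup\{\overrightarrow{ab}\})$ for some (equivalently any) arc $\overrightarrow{ab}$. Jacobian: a cycle is a minimal $C\subseteq E(G)\sqcup E(G^* )$ containing at most one of $e,e^*$ for each $e$ with $\Sigma\setminus C$ having two components; a signed cycle is $\partial D$ for a component $D$, with entry $\pm1$ on $e\in C$ according as the boundary orientation agrees with the reference orientation. $\pi(z)(e)=z(e)+z(e^* )$. $x_1\sim_J x_2$ iff $x_1-x_2$ lies in the integer span of $\pi$ of signed cycles; $Jac(\mathcal{C}(G,\Sigma))=\mathbb{Z}^{E(G)}/\sim_J$. Orientations of $G$ are vectors $\mathbf{O}\in\{\pm\tfrac12\}^{E(G)}$ ($+\tfrac12$ = agrees with reference); circuit reversal classes are classes of $\sim_J$ restricted to orientations. $Jac$ acts simply transitively on circuit reversal classes by $\mathbf{v}\cdot[\mathbf{O}_1]=[\mathbf{O}_2]$ iff $\mathbf{v}+\mathbf{O}_1\sim_J\mathbf{O}_2$. Bernardi bijection (fix $e_0\in E(G)$): for a quasi-tree $Q$, number the half-edges crossed by $\mathcal{E}_Q$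 in order of crossing, starting with whichever of ${\rm primal}^-(e_0)$, ${\rm dual}^+(e_0)$ is crossed. Set $\mathbf{O}_Q(e)=+\tfrac12$ iff either $e\notin Q$ and ${\rm primal}^+(e)$ is crossed before ${\rm primal}^-(e)$, or $e\in Q$ and ${\rm dual}^-(e)$ is crossed before ${\rm dual}^+(e)$; otherwise $-\tfrac12$. $Q\mapsto[\mathbf{O}_Q]$ is a bijection onto circuit reversal classes, and the Bernardi action $\Gamma(\mathbf{v},Q)$ is the quasi-tree $Q'$ with $[\mathbf{O}_{Q'}]=\mathbf{v}\cdot[\mathbf{O}_Q]$; it does not depend on $e_0$. The map $\varphi$ respects $\sim_J$ and induces a group isomorphism $\bar\varphi$. *)

(* Defs.v *)
From HB Require Import structures.
From Stdlib Require Import Relations.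
From mathcomp Require Import all_boot all_order all_algebra all_fingroup.
From mathcomp Require Import generic_quotient ring_quotient.
From mathcomp Require Import boolp.

Set Implicit Arguments.
Unset Strict Implicit.
Unset Printing Implicit Defensive.

Import GRing.Theory.
Local Open Scope ring_scope.

(** * Integer spans and quotients by them *)

Definition int_span (V : zmodType) (s : seq V) : {pred V} :=
  fun x => `[< inIntSpan (in_tuple s) x >].

Section IntegerSpan.
Variables (V : zmodType) (s : seq V).

Lemma int_span_zmod_closed : zmod_closed (int_span s).
Proof.
split=> [|x y /asboolP [a ->] /asboolP [b ->]]; apply/asboolP.
  by exists 0; rewrite big1 // => i _; rewrite ffunE mulr0z.
exists (a - b); rewrite -sumrB; apply: eq_bigr => i _.
by rewrite !ffunE mulrzBr.
Qed.

HB.instance Definition _ :=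
  GRing.isZmodClosed.Build V (int_span s) int_span_zmod_closed.

End IntegerSpan.

(** * Ribbon graphs *)

(** An embedded graph is given by its rotation system.  The dart [(e, true)] is
    the end of the edge [e] at its head (and the half-edge primal^+(e)), the
    dart [(e, false)] its end at the tail, so that the reference orientation is
    built in.  [rot d] is the dart following [d] in the positive
    (counterclockwise) cyclic order around the vertex of [d]; vertices are the
    cycles of [rot].  A connected graph with at least one edge, cellularly
    embedded in a closed oriented surface, is the same thing as such a
    connected rotation system. *)
Record ribbon_graph := RibbonGraph {
  edge : finType;
  rot : {perm edge * bool};
  rot_connected : forall d d' : edge * bool,
    connect (fun a b => (b == rot a) || (b == (a.1, ~~ a.2))) d d'
}.

Notation dart G := (edge G * bool)%type.

(** The other end of the same edge. *)
Definition opp (G : ribbon_graph) (d : dart G) : dart G := (d.1, ~~ d.2).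

(** [inl e] is the edge [e] of [G], [inr e] is the dual edge [e]^* of [G]^*. *)
Notation overlay G := (edge G + edge G)%type.

(** A half of an edge of [G] or of [G]^*: [true] is the half with the head. *)
Notation half G := (overlay G * bool)%type.

Definition primal (G : ribbon_graph) (b : bool) (e : edge G) : half G :=
  (inl e, b).
Definition dual (G : ribbon_graph) (b : bool) (e : edge G) : half G :=
  (inr e, b).

(** ** Spanning quasi-trees *)

Section QuasiTree.
Variable G : ribbon_graph.

(** The dart [d] also stands for the corner between [d] and [rot d].  Follow
    the boundary of the neighbourhood of the spanning subgraph [(V(G), Q)],
    starting along the corner [d]: the next dart is [rot d]; if its edge is in
    [Q] the boundary runs along that edge to the corner at its other end, and
    otherwise it passes on to the next corner of the same vertex.  The boundary
    components are the cycles of this permutation of the corners. *)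
Definition boundary_step (Q : {set edge G}) (d : dart G) : dart G :=
  if (rot G d).1 \in Q then opp (rot G d) else rot G d.

Lemma boundary_step_inj Q : injective (boundary_step Q).
Proof.
move=> d d'; rewrite /boundary_step /opp => eq_dd'; apply: (@perm_inj _ (rot G)).
move: eq_dd'; case: (rot G d) (rot G d') => [e b] [e' b'] /=.
have [eQ|eNQ] := boolP (e \in Q); have [e'Q|e'NQ] := boolP (e' \in Q) => -[ee' bb'].
- by rewrite ee' (negb_inj bb').
- by rewrite ee' (negPf e'NQ) in eQ.
- by rewrite ee' e'Q in eNQ.
- by rewrite ee' bb'.
Qed.

Definition boundary_perm (Q : {set edge G}) : {perm dart G} :=
  perm (@boundary_step_inj Q).

Definition quasi_tree (Q : {set edge G}) : bool :=
  #|porbits (boundary_perm Q)| == 1%N.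

End QuasiTree.

(** * The Jacobian *)

Section Jacobian.
Variable G : ribbon_graph.

(** [G] and [G]^* together cut the surface into quadrilaterals, one in each
    corner; the quadrilateral in the corner between [d] and [rot d] is named by
    [d].  With [e] pointing north (hence [e]^* pointing west), the four
    quadrilaterals at v_e are: *)
Definition quadNE (e : edge G) : dart G := (e, true).
Definition quadSW (e : edge G) : dart G := (e, false).
Definition quadNW (e : edge G) : dart G := (rot G)^-1%g (e, true).
Definition quadSE (e : edge G) : dart G := (rot G)^-1%g (e, false).

(** The quadrilaterals on the left and on the right of a half-edge, with respect
    to the reference orientation. *)
Definition left_quad (h : half G) : dart G :=
  match h with
  | (inl e, true) => quadNW e | (inl e, false) => quadSW e
  | (inr e, true) => quadSW e | (inr e, false) => quadSE e
  end.
Definition right_quad (h : half G) : dart G :=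
  match h with
  | (inl e, true) => quadNE e | (inl e, false) => quadSE e
  | (inr e, true) => quadNW e | (inr e, false) => quadNE e
  end.

Definition adjacent_off (C : {set overlay G}) : rel (dart G) := fun q q' =>
  [exists h : half G, (h.1 \notin C) &&
    (((left_quad h == q) && (right_quad h == q')) ||
     ((left_quad h == q') && (right_quad h == q)))].

(** The components of the complement of [C] in the surface, as sets of
    quadrilaterals. *)
Definition regions (C : {set overlay G}) : {set {set dart G}} :=
  equivalence_partition (connect (adjacent_off C)) [set: dart G].

Definition separating (C : {set overlay G}) : bool :=
  [forall e : edge G, ~~ ((inl e \in C) && (inr e \in C))]
  && (#|regions C| == 2).

Definition is_cycle (C : {set overlay G}) : bool := minset separating C.

(** The boundary of the region [D], oriented with [D] on its left.  (The two
    halves of an edge of a cycle have the same region on their left.) *)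
Definition region_boundary (C : {set overlay G}) (D : {set dart G}) :
    {ffun overlay G -> int} :=
  [ffun x => if x \in C then (if left_quad (x, true) \in D then 1 else -1)
             else 0].

Definition fold_dual (z : {ffun overlay G -> int}) : {ffun edge G -> int} :=
  [ffun e => z (inl e) + z (inr e)].

Definition folded_signed_cycles : seq {ffun edge G -> int} :=
  [seq fold_dual (region_boundary p.1 p.2)
  | p : {set overlay G} * {set dart G} in
      [pred p | is_cycle p.1 && (p.2 \in regions p.1)]].

Definition cycle_lattice : zmodClosed {ffun edge G -> int} :=
  int_span folded_signed_cycles.

Definition Jac : zmodType := Quotient.quot cycle_lattice.

(** The relation ~_J, on vectors that need not be integral. *)
Definition simJ (x y : {ffun edge G -> rat}) : Prop :=
  exists2 z : {ffun edge G -> int}, z \in cycle_lattice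
    & x - y = [ffun e => (z e)%:Q].

End Jacobian.

(** * The medial digraph and its Eulerian tours *)

Section Medial.
Variable G : ribbon_graph.

(** The nodes v_e of the medial digraph are named by [e].  The arc defined by
    the edge end [d] is named by [d]; it lies in the quadrilateral [d]. *)
Notation arc := (dart G).
Definition src (a : arc) : edge G := a.1.
Definition tgt (a : arc) : edge G := (rot G a).1.

(** At v_e, with [e] pointing north: the out-arc [(e, true)] is in the NE
    quadrilateral, between dual^-(e) and primal^+(e); the out-arc [(e, false)] in
    the SW one, between dual^+(e) and primal^-(e). *)
Definition med_minus (e : edge G) : arc := (e, true).
Definition med_plus (e : edge G) : arc := (e, false).

Definition chi (a : arc) : {ffun edge G -> int} :=
  [ffun n => (n == tgt a)%:R - (n == src a)%:R].

(** ** The sandpile group *)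

Definition zero_sum : {pred {ffun edge G -> int}} := fun x => \sum_n x n == 0.

Lemma zero_sum_zmod_closed : zmod_closed zero_sum.
Proof.
split=> [|x y /eqP x0 /eqP y0]; apply/eqP.
  by rewrite big1 // => n _; rewrite ffunE.
by under eq_bigr do rewrite !ffunE; rewrite sumrB x0 y0 subrr.
Qed.

HB.instance Definition _ := GRing.isZmodClosed.Build
  {ffun edge G -> int} zero_sum zero_sum_zmod_closed.

Record zs_vector :=
  ZsVector { zs_val :> {ffun edge G -> int}; _ : zs_val \in zero_sum }.

HB.instance Definition _ := [isSub for zs_val].
HB.instance Definition _ := [Choice of zs_vector by <:].
HB.instance Definition _ := [SubChoice_isSubZmodule of zs_vector by <:].

Lemma chi_zero_sum (a : arc) : chi a \in zero_sum.
Proof.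
have sum1 (m : edge G) : \sum_n ((n == m)%:R : int) = 1.
  by rewrite (bigD1 m) //= eqxx big1 ?addr0 // => n /negPf ->.
apply/eqP; under eq_bigr do rewrite ffunE.
by rewrite sumrB !sum1 subrr.
Qed.

Definition zs_chi (a : arc) : zs_vector := ZsVector (chi_zero_sum a).

Definition firing (n : edge G) : zs_vector := \sum_(a | src a == n) zs_chi a.

Definition firing_lattice : zmodClosed zs_vector :=
  int_span [seq firing n | n : edge G].

Definition sandpile : zmodType := Quotient.quot firing_lattice.

(** ** Eulerian tours *)

(** A tour, as a cyclic sequence of arcs, is encoded by the permutation sending
    each arc to the next one. *)
Definition eulerian (t : {perm arc}) : bool :=
  [forall a, tgt a == src (t a)] && [forall a, porbit t a == [set: arc]].

Definition tour_from (t : {perm arc}) (a : arc) : seq arc :=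
  traject t a #|{: arc}|.

(** The half-edge crossed by the passage from the in-arc [a] to the out-arc [a'].
    The in-arc [a] reaches v_f, [f] being the edge of [rot a], between the halves
    [primal b f] and [dual b f] for [b := (rot a).2]; the out-arc [rot a] is the
    one on the other side of [primal b f], the other out-arc [opp (rot a)] the one
    on the other side of [dual b f]. *)
Definition crossed_half (a a' : arc) : half G :=
  if a' == rot G a then primal (rot G a).2 (rot G a).1
  else dual (rot G a).2 (rot G a).1.

Definition crossings (t : {perm arc}) (a : arc) : seq (half G) :=
  [seq crossed_half b (t b) | b <- tour_from t a].

Definition bouchet (t : {perm arc}) : {set edge G} :=
  [set e | ~~ [exists a, (crossed_half a (t a)).1 == inl e]].

(** The inverse of Bouchet's bijection (with junk value 1 off its domain). *)
Definition tour_of (Q : {set edge G}) : {perm arc} :=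
  odflt 1%g [pick t | eulerian t && (bouchet t == Q)].

(** ** The tour-rotor action *)

(** The out-arcs at nodes other than the starting node that are the last ones of
    their node to be traversed by the tour started with [a]. *)
Definition arborescence (t : {perm arc}) (a : arc) : {set arc} :=
  [set b | (src b != src a) && [forall c, (src c == src b) ==>
     (index c (tour_from t a) <= index b (tour_from t a))%N]].

(** Chips on the nodes, and a set of out-arcs containing one arc at each node. *)
Notation config := ({ffun edge G -> int} * {set arc})%type.

(** Routing at the node [src a]; [opp a] is the out-arc other than [a]. *)
Inductive routing : config -> config -> Prop :=
  Routing (x : {ffun edge G -> int}) (rho : {set arc}) (a : arc) :
    a \in rho -> routing (x, rho) (x + chi (opp a), opp a |: (rho :\ a)).

Definition tour_rotor_rel (x : sandpile) (t t' : {perm arc}) : Prop :=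
  exists a : arc,
    clos_refl_trans _ routing
      (zs_val (repr x), a |: arborescence t a) (0, a |: arborescence t' a).

(** The tour r(x, t); it exists and is unique when [t] is an Eulerian tour. *)
Definition tour_rotor (x : sandpile) (t : {perm arc}) : {perm arc} :=
  odflt t [pick t' | eulerian t' && `[< tour_rotor_rel x t t' >]].

End Medial.

(** * The Bernardi action *)

Section Bernardi.
Variables (G : ribbon_graph) (e0 : edge G).

(** The half-edges crossed by the tour of [Q], in order of crossing. *)
Definition crossing_order (Q : {set edge G}) : seq (half G) :=
  let s := crossings (tour_of Q) (med_plus e0) in
  seq.rot (find (pred2 (primal false e0) (dual true e0)) s) s.

Definition crossed_before (Q : {set edge G}) (h h' : half G) : bool :=
  (index h (crossing_order Q) < index h' (crossing_order Q))%N.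

Definition bernardi_orientation (Q : {set edge G}) : {ffun edge G -> rat} :=
  [ffun e =>
    if (e \notin Q) && crossed_before Q (primal true e) (primal false e)
       || (e \in Q) && crossed_before Q (dual false e) (dual true e)
    then 1 / 2 else - (1 / 2)].

(** The action v . [O1] = [O2] on circuit reversal classes. *)
Definition moves_class (v : Jac G) (O1 O2 : {ffun edge G -> rat}) : Prop :=
  simJ ([ffun e => (repr v e)%:Q] + O1) O2.

(** The quasi-tree Gamma(v, Q); it exists and is unique when [Q] is a spanning
    quasi-tree. *)
Definition bernardi (v : Jac G) (Q : {set edge G}) : {set edge G} :=
  odflt Q [pick Q' | quasi_tree Q' &&
    `[< moves_class v (bernardi_orientation Q) (bernardi_orientation Q') >]].

End Bernardi.

(** * The isomorphism between the two groups *)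

Section Isomorphism.
Variable G : ribbon_graph.

Definition phi (z : {ffun edge G -> int}) : zs_vector G :=
  \sum_e (- zs_chi (med_plus e)) *~ z e.

Definition phibar (v : Jac G) : sandpile G :=
  \pi_(sandpile G)%qT (phi (repr v)).

End Isomorphism.

(* Main.v *)
(** The rotor picked by a tour [t] started at an arc [a] records, at each edge [e],
    whether [med_plus e] is the last out-arc of v_e traversed; writing
    [exit_vector t a] for its indicator, the Bernardi orientation of [Q] is
    [exit_vector] up to a constant that does not depend on [Q].  Hence the
    Bernardi action compares [v + exit_vector t a] and [exit_vector t' a] modulo
    the lattice of signed cycles.  Reachability by routings, on the other side,
    compares the images of these two vectors under [e |-> chi (med_plus e)]
    modulo firings.  The two lattices correspond: both consist of the vectors
    [e |-> f (med_plus e) - f (med_minus e)] for integer circulations [f] on the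
    medial digraph, because an arc is also a quadrilateral of the surface and a
    0/1 circulation is the indicator of a union of regions.  Following the tour
    by one arc changes [exit_vector] by a single routing, so the choice of [a]
    does not matter; and the maximum of a circulation relating two tours is
    attained at the root, so the resulting tour is unique. *)
Require Import Defs.
From Stdlib Require Import Relations.
From mathcomp Require Import all_boot all_order all_algebra all_fingroup.
From mathcomp Require Import generic_quotient ring_quotient.
From mathcomp Require Import boolp zify ring.
(* [rot] and [opp] are those of ribbon graphs, not the library's. *)
Import Defs.

Set Implicit Arguments.
Unset Strict Implicit.
Unset Printing Implicit Defensive.

Import Order.TTheory GRing.Theory Num.Theory.
Local Open Scope ring_scope.

(** * Integer spans *)

Section IntSpan.
Variable V : zmodType.

Lemma mem_int_span (s : seq V) x : x \in s -> x \in int_span s.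
Proof.
move=> xs; have xi : (index x s < size s)%N by rewrite index_mem.
apply/asboolP; exists [ffun i => (i == Ordinal xi)%:R].
rewrite (bigD1 (Ordinal xi)) //= ffunE eqxx mulr1z nth_index // big1 ?addr0 //.
by move=> i /negPf ii; rewrite ffunE ii mulr0z.
Qed.

End IntSpan.

Lemma ffunMzE (I : finType) (V : zmodType) (f : {ffun I -> V}) n i :
  (f *~ n) i = f i *~ n.
Proof. by case: n => n; rewrite ?NegzE ?mulrNz -?pmulrn ?ffunE ffunMnE. Qed.

(** * Signed cycles as coboundaries *)

Section Cycles.
Variable G : ribbon_graph.
Implicit Types (B C : {set overlay G}) (f : dart G -> int) (e : edge G).

Definition exclusive C := [forall e : edge G, ~~ ((inl e \in C) && (inr e \in C))].

Lemma exclusive_inl C e : exclusive C -> inl e \in C -> inr e \notin C.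
Proof. by move=> /forallP/(_ e); case: (inl e \in C). Qed.

Lemma exclusive_inr C e : exclusive C -> inr e \in C -> inl e \notin C.
Proof. by move=> /forallP/(_ e); case: (inr e \in C); case: (inl e \in C). Qed.

Lemma exclusiveS B C : B \subset C -> exclusive C -> exclusive B.
Proof.
move=> /subsetP BC /forallP exC; apply/forallP => e; apply/negP => /andP[eB eB'].
by case/negP: (exC e); rewrite !BC.
Qed.

(** Functions that are locally constant on the complement of [C], the quadrilaterals being its
    cells. *)
Definition compatible C f :=
  forall h : half G, h.1 \notin C -> f (left_quad h) = f (right_quad h).

(** The jump of [f] at v_e, from the right to the left of whichever of [e], [e]^*
    separates the quadrilaterals there (see [compatible_jump]). *)
Definition coboundary f : {ffun edge G -> int} :=
  [ffun e => f (med_plus e) - f (med_minus e)].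

Definition overlay_edge (x : overlay G) : edge G :=
  match x with inl e => e | inr e => e end.

(** Only one of [e] and its dual lies in [C]; across the other one the quadrilaterals at v_e merge
    in pairs, and both halves of [x] separate the pair of SW (on the left) from that of NE. *)
Lemma compatible_jump C f x b : exclusive C -> compatible C f -> x \in C ->
  f (left_quad (x, b)) - f (right_quad (x, b)) = coboundary f (overlay_edge x).
Proof.
move=> exC fC; rewrite ffunE; case: x => e eC /=.
  have nC := exclusive_inl exC eC.
  have /= := fC (inr e, true) nC; have /= := fC (inr e, false) nC.
  by case: b; rewrite /quadNE /quadSW /med_plus /med_minus; lia.
have nC := exclusive_inr exC eC.
have /= := fC (inl e, true) nC; have /= := fC (inl e, false) nC.
by case: b; rewrite /quadNE /quadSW /med_plus /med_minus; lia.
Qed.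

Lemma compatible_remove C f x : exclusive C -> compatible C f -> x \in C ->
  coboundary f (overlay_edge x) = 0 -> compatible (C :\ x) f.
Proof.
move=> exC fC xC f0 [y b]; rewrite in_setD1 negb_and negbK /=.
case: (eqVneq y x) => [-> _|_ /= yC]; last exact: (fC (y, b)).
by apply/eqP; rewrite -subr_eq0 (compatible_jump b exC fC xC) f0.
Qed.

Lemma coboundaryB f g a :
  coboundary (fun d => f d - a * g d) =
  coboundary f - coboundary g *~ a.
Proof. by apply/ffunP => e; rewrite !ffunE ffunMzE !ffunE -mulrzr intz; ring. Qed.

Notation linked C := (connect (adjacent_off C)).

Lemma linked_sym C : connect_sym (adjacent_off C).
Proof.
apply: sym_connect_sym => q q'; apply: eq_existsb => h.
by rewrite orbC.
Qed.

Lemma linked_side C h : h.1 \notin C -> linked C (left_quad h) (right_quad h).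
Proof.
by move=> hC; apply: connect1; apply/existsP; exists h; rewrite hC !eqxx.
Qed.

Lemma compatible_linked C f q q' : compatible C f -> linked C q q' -> f q = f q'.
Proof.
move=> fC /connectP[p]; elim: p q => [q _ -> //|r p IHp q] /=.
move=> /andP[/existsP[h /andP[hC hq]] pr] lp.
rewrite -(IHp _ pr lp).
by case/orP: hq => /andP[/eqP<- /eqP<-]; rewrite fC.
Qed.

(** Crossing primal half-edges turns around a vertex, and SE joins NE to SW, which leads to the
    other end of an edge. *)
Lemma linked_set0 q q' : linked (set0 : {set overlay G}) q q'.
Proof.
have adj (h : half G) : linked set0 (left_quad h) (right_quad h).
  by apply: linked_side; rewrite in_set0.
apply: connect_sub (rot_connected q q') => d d' /orP[] /eqP ->.
  have := adj (inl (rot G d).1, (rot G d).2); case E: (rot G d) => [e []] /=.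
    by rewrite /quadNW /quadNE -E permK.
  by rewrite /quadSW /quadSE -E permK linked_sym.
have sw e : linked set0 (e, true) (e, false).
  apply: (@connect_trans _ _ (quadSE e)).
    by rewrite linked_sym; exact: (adj (inr e, false)).
  by rewrite linked_sym; exact: (adj (inl e, false)).
by case: d => e [] //=; rewrite linked_sym.
Qed.

(** At least two regions, where [separating] asks for exactly two: its failure means that everything
    is linked. [is_cycleP] reconciles the two notions. *)
Definition disconnected C := [exists q, exists q', ~~ linked C q q'].

Lemma disconnectedPn C :
  reflect (forall q q', linked C q q') (~~ disconnected C).
Proof.
rewrite negb_exists; apply: (iffP forallP) => con q; last first.
  by rewrite negb_exists; apply/forallP => q'; rewrite negbK.
by move=> q'; move: (con q); rewrite negb_exists => /forallP/(_ q'); rewrite negbK.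
Qed.

(** Without [x] everything is connected, so a path from the left of [x] to [q] meets [C] at most in
    [x]; after its last crossing of [x] it stays in the region of one of the two sides. *)
Lemma minimal_sides C x : exclusive C -> minset disconnected C -> x \in C ->
  (forall q, linked C (left_quad (x, true)) q || linked C (right_quad (x, true)) q)
  /\ ~~ linked C (left_quad (x, true)) (right_quad (x, true)).
Proof.
move=> exC /minsetP[disC minC] xC.
set l := left_quad _; set r := right_quad _.
have lx b : linked C l (left_quad (x, b)) /\ linked C r (right_quad (x, b)).
  have side (y : overlay G) c : y \notin C -> linked C (left_quad (y, c)) (right_quad (y, c)).
    by move=> yC; exact: (@linked_side C (y, c)).
  rewrite {}/l {}/r; case: b; first by rewrite !connect0.
  case: x xC => e eC /=.
    have nC := exclusive_inl exC eC; rewrite linked_sym.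
    by split; [exact: (side (inr e) true) | rewrite linked_sym; exact: (side (inr e) false)].
  have nC := exclusive_inr exC eC.
  by split; [exact: (side (inl e) false) | exact: (side (inl e) true)].
have near q : linked C l q || linked C r q.
  have : linked (C :\ x) l q.
    have : ~~ disconnected (C :\ x).
      apply/negP => /minC/(_ (subD1set _ _)) CE.
      by move: xC; rewrite -CE in_setD1 eqxx.
    by move/disconnectedPn; apply.
  move=> /connectP[p]; elim/last_ind: p q => [q _ ->|p q' IHp q] /=.
    by rewrite connect0.
  rewrite last_rcons rcons_path => /andP[/IHp/(_ erefl) IH adj] ->.
  have closed_step (y y' : dart G) : linked C y y' ->
      linked C l y || linked C r y -> linked C l y' || linked C r y'.
    by move=> yy' /orP[] /connect_trans/(_ yy') ->; rewrite ?orbT.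
  case/existsP: adj => -[y b] /andP[/= yC].
  have [yx|ynx] := eqVneq y x.
    by rewrite yx; have [ll rr] := lx b; case/orP=> /andP[/eqP h1 /eqP h2];
      rewrite -?h1 -?h2 ?ll ?rr ?orbT.
  have nyC : y \notin C by move: yC; rewrite in_setD1 ynx.
  have yy := @linked_side C (y, b) nyC.
  case/orP=> /andP[/eqP h1 /eqP h2]; apply: closed_step IH; rewrite -h1 -h2 //.
  by rewrite linked_sym.
split=> //; apply/negP => lr; case/existsP: disC => q /existsP[q' /negP[]].
have all_l y : linked C l y.
  by case/orP: (near y) => //; apply: connect_trans.
by apply: connect_trans (all_l q'); rewrite linked_sym.
Qed.

Lemma disconnected_neq0 C : disconnected C -> exists x, x \in C.
Proof.
move=> disC; apply/set0Pn/negP => /eqP C0.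
by case/existsP: disC => q /existsP[q' /negP[]]; rewrite C0 linked_set0.
Qed.

Definition linked_class C q := [set q' | linked C q q'].

Lemma mem_regions C (D : {set dart G}) :
  reflect (exists q, D = linked_class C q) (D \in regions C).
Proof.
have classE q : [set y in [set: dart G] | linked C q y] = linked_class C q.
  by apply/setP => y; rewrite !inE.
apply: (iffP imsetP) => [[q _ ->]|[q ->]]; exists q; rewrite ?inE //.
Qed.

(** An exclusive minimal disconnected set has exactly two regions by [minimal_sides], so it is
    minimal separating. Conversely a minimal separating set contains a minimal disconnected one,
    which is separating too, hence is all of it. *)
Lemma is_cycleP C : reflect (exclusive C /\ minset disconnected C) (is_cycle C).
Proof.
have sep_disc B : separating B -> disconnected B.
  case/andP=> _ /eqP B2; apply: contraT => conB.
  have : regions B \subset [set setT].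
    apply/subsetP => D /mem_regions[q ->]; rewrite inE; apply/eqP/setP => q'.
    by rewrite !inE (disconnectedPn _ conB).
  by move/subset_leq_card; rewrite B2 cards1.
have min_sep B : exclusive B -> minset disconnected B -> is_cycle B.
  move=> exB minB; have [disB minB'] := minsetP minB.
  have [x xB] := disconnected_neq0 disB.
  have [near far] := minimal_sides exB minB xB.
  set l := left_quad _ in near far; set r := right_quad _ in near far.
  apply/minsetP; split; last first.
    by move=> A /sep_disc disA AB; apply: minB'.
  rewrite /separating -/(exclusive B) exB /=.
  suff -> : regions B = [set linked_class B l; linked_class B r].
    rewrite cards2; case: (linked_class B l =P _) => // lr; case/negP: far.
    have : r \in linked_class B l by rewrite lr inE connect0.
    by rewrite inE.
  have classE y q : linked B y q -> linked_class B q = linked_class B y.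
    move=> yq; apply/setP => z; rewrite !inE; apply/idP/idP.
      exact: connect_trans.
    by apply: connect_trans; rewrite linked_sym.
  apply/setP => D; apply/mem_regions/set2P => [[q ->]|[->|->]]; last 2 first.
  - by exists l.
  - by exists r.
  by case/orP: (near q) => /classE; [left|right].
apply: (iffP idP) => [cycC|[]]; last exact: min_sep.
have [sepC minC] := minsetP cycC.
have exC : exclusive C by case/andP: sepC.
split=> //; apply/minsetP; split=> [|A disA AC]; first exact: sep_disc.
have [B minB BA] := minset_exists disA.
have BC := subset_trans BA AC.
have [sepB _] := minsetP (min_sep B (exclusiveS BC exC) minB).
by apply/eqP; rewrite eqEsubset AC -(minC _ sepB BC).
Qed.

Definition indicator (D : {set dart G}) : dart G -> int := fun d => (d \in D)%:R.

Lemma region_compatible C (D : {set dart G}) :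
  D \in regions C -> compatible C (indicator D).
Proof.
case/mem_regions=> q -> h hC; rewrite /indicator !inE.
suff -> : linked C q (left_quad h) = linked C q (right_quad h) by [].
apply/idP/idP => /connect_trans; apply; last rewrite linked_sym; exact: linked_side.
Qed.

Lemma region_sides C (D : {set dart G}) x : is_cycle C -> D \in regions C ->
  x \in C -> (right_quad (x, true) \in D) = (left_quad (x, true) \notin D).
Proof.
case/is_cycleP=> exC minC /mem_regions[q ->] xC; rewrite !inE.
have [near far] := minimal_sides exC minC xC.
apply/idP/idP => [qr|/negPf qNl].
  by apply: contra far; rewrite linked_sym => /connect_trans; apply.
by have := near q; rewrite !(linked_sym _ _ q) qNl.
Qed.

(** At most one of [e] and its dual contributes, with the jump of the indicator as its sign; if
    neither is in [C], then NE, SE and SW lie in one region and both sides vanish. *)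
Lemma fold_region_boundary C (D : {set dart G}) : is_cycle C -> D \in regions C ->
  fold_dual (region_boundary C D) = coboundary (indicator D).
Proof.
move=> cycC DC; have [exC _] := is_cycleP _ cycC.
have fC := region_compatible DC.
have side x : x \in C -> (if left_quad (x, true) \in D then 1 else -1) =
    coboundary (indicator D) (overlay_edge x).
  move=> xC; rewrite -(compatible_jump true exC fC xC) /indicator.
  by rewrite (region_sides cycC DC xC); case: (_ \in D).
apply/ffunP => e; rewrite !ffunE.
have [eC|eNC] := boolP (inl e \in C).
  by rewrite (negPf (exclusive_inl exC eC)) addr0 (side _ eC) ffunE.
have [eC|eNC'] := boolP (inr e \in C).
  by rewrite add0r (side _ eC) ffunE.
have /= := fC (inl e, false) eNC; have /= := fC (inr e, false) eNC'.
by rewrite /quadSE /quadSW /quadNE /med_plus /med_minus => h1 h2; rewrite h2 h1 [RHS]subrr.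
Qed.

(** If [f] is not constant, [C] contains a cycle; subtracting from [f] a multiple of
    the indicator of one side of it makes [f] continuous across one more edge. *)
Lemma compatible_coboundary C f : exclusive C -> compatible C f ->
  coboundary f \in cycle_lattice G.
Proof.
have [n] := ubnP #|C|; elim: n C f => // n IHn C f /ltnSE leCn exC fC.
have [/existsP[q /existsP[q' qq']]|fcst] :=
  boolP [exists q, exists q', f q != f q']; last first.
  suff -> : coboundary f = 0 by apply: rpred0.
  apply/ffunP => e; rewrite !ffunE; move/existsPn/(_ (med_plus e)): fcst.
  by move/existsPn/(_ (med_minus e)); rewrite negbK => /eqP ->; rewrite subrr.
have disC : disconnected C.
  apply/existsP; exists q; apply/existsP; exists q'.
  by apply: contra qq' => /(compatible_linked fC) ->.
have [B minB BC] := minset_exists disC.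
have exB := exclusiveS BC exC.
have cycB : is_cycle B by apply/is_cycleP.
have [x xB] := disconnected_neq0 (minsetp minB).
have xC := subsetP BC _ xB.
pose R := linked_class B (left_quad (x, true)).
have RB : R \in regions B by apply/mem_regions; exists (left_quad (x, true)).
(* The coefficient is the jump of [f] across [x]; as [R] lies on the left of [x], its indicator
   jumps by 1 there. *)
pose g : dart G -> int := fun d => f d - coboundary f (overlay_edge x) * indicator R d.
have gR : coboundary (indicator R) (overlay_edge x) = 1.
  rewrite -(compatible_jump true exB (region_compatible RB) xB) /indicator.
  by rewrite (region_sides cycB RB xB) inE connect0.
have gC : compatible C g.
  move=> h hC; rewrite /g fC // (region_compatible RB) //.
  by apply: contra hC; apply: (subsetP BC).
have g0 : coboundary g (overlay_edge x) = 0.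
  by rewrite coboundaryB ffunE [X in _ + X]ffunE ffunMzE gR intz subrr.
rewrite -[coboundary f](subrK
  (coboundary (indicator R) *~ coboundary f (overlay_edge x))) -coboundaryB.
apply: rpredD.
  apply: (IHn (C :\ x)); last exact: compatible_remove.
    by move: leCn; rewrite (cardsD1 x) xC.
  by apply: exclusiveS exC; apply: subD1set.
apply: rpredMz; rewrite -(fold_region_boundary cycB RB); apply: mem_int_span.
by apply/mapP; exists (B, R); rewrite ?mem_enum ?inE ?cycB.
Qed.

End Cycles.

(** * Circulations on the medial digraph *)

Section Circulations.
Variable G : ribbon_graph.
Implicit Types (f : dart G -> int) (e : edge G).

Definition circulation f := forall e,
  f ((rot G)^-1%g (e, true)) + f ((rot G)^-1%g (e, false)) = f (e, true) + f (e, false).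

Lemma sum_dart (V : nmodType) (F : dart G -> V) :
  \sum_d F d = \sum_e (F (e, true) + F (e, false)).
Proof.
transitivity (\sum_e \sum_b F (e, b)); first by rewrite pair_bigA; apply: eq_bigr => -[].
by apply: eq_bigr => e _; rewrite big_bool.
Qed.

Lemma sum_in_arcs (V : nmodType) (F : dart G -> V) e :
  \sum_(d | tgt d == e) F d = F ((rot G)^-1%g (e, true)) + F ((rot G)^-1%g (e, false)).
Proof.
rewrite (reindex_inj (@perm_inj _ (rot G)^-1%g)) /= big_mkcond sum_dart.
rewrite /tgt (bigD1 e) //= !permKV /= eqxx big1 ?addr0 // => n /negPf ne.
by rewrite !permKV /= ne addr0.
Qed.

Lemma sum_out_arcs (V : nmodType) (F : dart G -> V) e :
  \sum_(d | src d == e) F d = F (e, true) + F (e, false).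
Proof.
rewrite big_mkcond sum_dart (bigD1 e) //= eqxx big1 ?addr0 // => n /negPf ne.
by rewrite ne addr0.
Qed.

Lemma circulationB f g : circulation f -> circulation g ->
  circulation (fun d => f d - g d).
Proof. by move=> cf cg e; have := cf e; have := cg e; lia. Qed.

Lemma circulation_in_out f e : circulation f ->
  \sum_(d | tgt d == e) f d = \sum_(d | src d == e) f d.
Proof. by move=> cf; rewrite sum_in_arcs sum_out_arcs. Qed.

(** The in-arcs lie in NW and SE, the out-arcs in NE and SW; continuity across [e] or across its
    dual gives each in-arc the value of a different out-arc. *)
Lemma compatible_circulation (C : {set overlay G}) f :
  exclusive C -> compatible C f -> circulation f.
Proof.
move=> exC fC e; have [eC|eNC] := boolP (inl e \in C).
  have nC := exclusive_inl exC eC.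
  have /= := fC (inr e, true) nC; have /= := fC (inr e, false) nC.
  by rewrite /quadNE /quadSW /quadNW /quadSE; lia.
have /= := fC (inl e, true) eNC; have /= := fC (inl e, false) eNC.
by rewrite /quadNE /quadSW /quadNW /quadSE; lia.
Qed.

Lemma chi_sum f n : (\sum_d chi d *~ f d) n =
  \sum_(d | tgt d == n) f d - \sum_(d | src d == n) f d.
Proof.
rewrite sum_ffunE [X in X - _]big_mkcond [X in _ - X]big_mkcond -sumrB.
apply: eq_bigr => d _; rewrite ffunMzE ffunE !(eq_sym n).
by case: eqP => _; case: eqP => _ /=; rewrite -mulrzl; ring.
Qed.

Lemma circulation_chi f : circulation f <-> \sum_d chi d *~ f d = 0.
Proof.
split=> [cf|f0 e]; first by apply/ffunP => n; rewrite chi_sum circulation_in_out // subrr ffunE.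
have := chi_sum f e; rewrite f0 ffunE sum_in_arcs sum_out_arcs; lia.
Qed.

(** A 0/1-valued circulation never contains exactly the two in-arcs, or exactly
    the two out-arcs, of a node: at each node it is separated by [e] or by
    its dual. *)
Lemma bool_circulation (D : {set dart G}) : circulation (indicator D) ->
  coboundary (indicator D) \in cycle_lattice G.
Proof.
move=> cD; set f := indicator D.
(* [C] takes [e] when [f] jumps across [e], and its dual otherwise. In the first case conservation
   and the values 0, 1 leave no jump across the dual. *)
pose along e := (f (quadNW e) == f (quadNE e)) && (f (quadSE e) == f (quadSW e)).
pose C := [set x : overlay G | match x with inl e => ~~ along e | inr e => along e end].
apply: (@compatible_coboundary _ C).
  by apply/forallP => e; rewrite !inE; case: (along e).
have bF d : f d = 0 \/ f d = 1 by rewrite /f /indicator; case: (d \in D); [right|left].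
move=> [[] e b]; rewrite inE /= /along; have := cD e; rewrite -/f.
  rewrite negbK => _ /andP[/eqP h1 /eqP h2]; case: b => //=.
have := bF (quadNW e); have := bF (quadNE e); have := bF (quadSE e); have := bF (quadSW e).
rewrite /quadNE /quadSW /quadNW /quadSE negb_and.
case: b => h1 h2 h3 h4 h5 /orP[] /eqP; lia.
Qed.

(** Choose at each node an out-arc with positive flow if there is one: a minimal
    nonempty set of nodes stable under following these arcs is permuted by it. *)
Lemma positive_circulation f : circulation f -> (forall d, 0 <= f d) ->
  (exists d, 0 < f d) ->
  exists D : {set dart G}, [/\ D != set0, circulation (indicator D)
                        & forall d, d \in D -> 0 < f d].
Proof.
move=> cf f_ge0 [d0 d0_gt0].
pose s e := (e, 0 < f (e, true)); pose h e := tgt (s e).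
pose stable (N : {set edge G}) := (N != set0) && [forall e in N, (0 < f (s e)) && (h e \in N)].
pose N0 := [set e | (0 < f (e, true)) || (0 < f (e, false))].
have N0s e : e \in N0 -> 0 < f (s e).
  by rewrite inE /s; case E: (0 < f (e, true)).
have stN0 : stable N0.
  apply/andP; split.
    apply/set0Pn; exists d0.1; rewrite inE; case: d0 d0_gt0 => e [] /= ->; rewrite ?orbT //.
  apply/forall_inP => e /N0s se; rewrite se /=.
  have : 0 < \sum_(d | tgt d == h e) f d.
    rewrite (bigD1 (s e)) //= ltr_pwDl // sumr_ge0 // => d _; exact: f_ge0.
  rewrite (circulation_in_out _ cf) sum_out_arcs inE.
  have := f_ge0 (h e, true); have := f_ge0 (h e, false); lia.
have [N minN _] := minset_exists stN0.
have [/andP[N_neq0 /forall_inP stN] minN'] := minsetP minN.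
(* The image of [N] is stable and lies in [N]; minimality makes [h] a permutation of [N], so each
   node of [N] receives exactly one chosen arc. *)
have hN : h @: N = N.
  apply: minN'; last by apply/subsetP => _ /imsetP[e eN ->]; case/andP: (stN _ eN).
  apply/andP; split; first by rewrite imset_eq0.
  apply/forall_inP => _ /imsetP[e eN ->]; case/andP: (stN _ eN) => _ heN.
  by case/andP: (stN _ heN) => -> _; rewrite imset_f.
have h_inj : {in N &, injective h} by apply/imset_injP; rewrite hN.
exists (s @: N); split; first by rewrite imset_eq0.
  move=> n; rewrite -sum_in_arcs -sum_out_arcs.
  have sumD (P : pred (dart G)) :
      \sum_(d | P d) indicator (s @: N) d = \sum_(e in N) (P (s e))%:R.
    rewrite big_mkcond /= (eq_bigr (fun d => if d \in s @: N then (P d)%:R : int else 0)).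
      by rewrite -big_mkcond big_imset // => x y _ _ [].
    by move=> d _; rewrite /indicator; case: (P d); case: (_ \in _).
  rewrite !sumD.
  have -> : \sum_(e in N) (tgt (s e) == n)%:R = \sum_(e in h @: N) (e == n)%:R :> int.
    by rewrite big_imset.
  by rewrite hN.
by move=> _ /imsetP[e eN ->]; case/andP: (stN _ eN).
Qed.

(** Constants have zero coboundary, so [f] may be shifted to be nonnegative; 0/1 circulations are
    then subtracted until the total flow is 0. *)
Lemma circulation_coboundary f : circulation f -> coboundary f \in cycle_lattice G.
Proof.
have nonneg (k : nat) g : circulation g -> (forall d, 0 <= g d) ->
    \sum_d g d <= k%:Z -> coboundary g \in cycle_lattice G.
  elim: k g => [|k IHk] g cg g_ge0 le_g.
    have g0 : forall d, g d = 0.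
      have /eqP := le_anti (introT andP (conj le_g (sumr_ge0 _ (fun d _ => g_ge0 d)))).
      by rewrite psumr_eq0 // => /allP g0 d; apply/eqP/g0; rewrite mem_index_enum.
    suff -> : coboundary g = 0 by apply: rpred0.
    by apply/ffunP => e; rewrite !ffunE !g0.
  have [/existsP gpos|/existsPn gnpos] := boolP [exists d, 0 < g d]; last first.
    apply: IHk => //; rewrite big1 // => d _; apply/eqP.
    by rewrite eq_le g_ge0 leNgt gnpos.
  have [D [D_neq0 cD posD]] := positive_circulation cg g_ge0 gpos.
  rewrite -[coboundary g](subrK (coboundary (indicator D) *~ 1)) -coboundaryB.
  apply: rpredD; last exact/rpredMz/bool_circulation.
  apply: IHk.
  - by apply: circulationB => // e; have := cD e; lia.
  - move=> d; rewrite /indicator mul1r; have := g_ge0 d; case: (boolP (d \in D)) => [/posD|_]; lia.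
  rewrite sumrB -mulr_sumr mul1r.
  have : 1 <= \sum_d indicator D d.
    have /set0Pn[d dD] := D_neq0; rewrite (bigD1 d) //= /indicator dD lerDl.
    by apply: sumr_ge0 => d' _; case: (_ \in _).
  move=> D_ge1; rewrite lerBlDr (le_trans le_g) // intS addrC.
  by rewrite lerD2l.
move=> cf; pose m := \sum_d `|f d|.
have le_m d : - m <= f d.
  have : `|f d| <= m by rewrite /m (bigD1 d) //= lerDl sumr_ge0.
  lia.
pose g d := f d + m.
have -> : coboundary f = coboundary g by apply/ffunP => e; rewrite !ffunE /g; lia.
have g_ge0 d : 0 <= g d by rewrite /g; have := le_m d; lia.
apply: (nonneg (absz (\sum_d g d)) g) => //; last by rewrite lez_abs.
by move=> e; have := cf e; rewrite /g; lia.
Qed.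

Lemma cycle_latticeP (z : {ffun edge G -> int}) :
  z \in cycle_lattice G <-> exists2 f, circulation f & z = coboundary f.
Proof.
split=> [|[f cf ->]]; last exact: circulation_coboundary.
case/asboolP => a ->.
pose s := folded_signed_cycles G.
have gen i : (i < size s)%N -> exists2 f, circulation f & s`_i = coboundary f.
  move=> /(mem_nth 0)/mapP[[C D]]; rewrite mem_enum inE /= => /andP[cycC DC] ->.
  exists (indicator D); last exact: fold_region_boundary.
  have [exC _] := is_cycleP _ cycC.
  exact: compatible_circulation exC (region_compatible DC).
elim/big_ind: _ => [|x y [f cf ->] [g cg ->]|i _].
- exists (fun=> 0); first by move=> e.
  by apply/ffunP => e; rewrite !ffunE.
- exists (fun d => f d + g d); first by move=> e; have := cf e; have := cg e; lia.
  by apply/ffunP => e; rewrite !ffunE; ring.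
have [f cf ->] := gen i (ltn_ord i).
exists (fun d => f d * a i); first by move=> e; rewrite -!mulrDl cf.
by apply/ffunP => e; rewrite ffunMzE !ffunE -mulrzr intz; ring.
Qed.

(** * Firings of the medial digraph compared with signed cycles *)

Definition firing_vector e : {ffun edge G -> int} :=
  chi (med_plus e) + chi (med_minus e).

(** Firings as plain vectors, since the chip vectors of [routing] are not bundled with a zero-sum
    proof. *)
Definition chip_lattice : zmodClosed {ffun edge G -> int} :=
  int_span [seq firing_vector e | e : edge G].

Lemma firing_vector_lattice e : firing_vector e \in chip_lattice.
Proof. by apply/mem_int_span/map_f; rewrite mem_enum. Qed.

Lemma chip_latticeP u :
  u \in chip_lattice <-> exists c : edge G -> int, u = \sum_e firing_vector e *~ c e.
Proof.
split=> [|[c ->]]; last by apply: rpred_sum => e _; apply/rpredMz/firing_vector_lattice.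
case/asboolP => a ->; elim/big_ind: _ => [|x y [b ->] [c ->]|i _].
- by exists (fun=> 0); rewrite big1.
- exists (fun e => b e + c e); rewrite -big_split.
  by apply: eq_bigr => e _; rewrite mulrzDr.
have := mem_nth 0 (ltn_ord i); rewrite /= => /mapP[e _ ->].
exists (fun e' => a i *+ (e' == e)); rewrite (bigD1 e) //= eqxx big1 ?addr0 //.
by move=> e' /negPf ->.
Qed.

Lemma zs_val_sum (I : Type) (r : seq I) (P : pred I) (F : I -> zs_vector G) :
  zs_val (\sum_(i <- r | P i) F i) = \sum_(i <- r | P i) zs_val (F i).
Proof. exact: (raddf_sum (val : zs_vector G -> _)). Qed.

Lemma zs_valMz (u : zs_vector G) n : zs_val (u *~ n) = zs_val u *~ n.
Proof. exact: (raddfMz (val : zs_vector G -> _)). Qed.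

Lemma firing_latticeP (u : zs_vector G) :
  (u \in firing_lattice G) = (zs_val u \in chip_lattice).
Proof.
have valE e : zs_val (firing e) = firing_vector e.
  by rewrite /firing zs_val_sum sum_out_arcs addrC.
apply/idP/idP => [|/chip_latticeP[c uE]].
  case/asboolP => a ->; rewrite zs_val_sum rpred_sum // => i _.
  have := mem_nth 0 (ltn_ord i); rewrite zs_valMz => /mapP[e _ ->].
  by rewrite valE; apply/rpredMz/firing_vector_lattice.
suff -> : u = \sum_e firing e *~ c e.
  by apply: rpred_sum => e _; apply/rpredMz/mem_int_span/map_f; rewrite mem_enum.
apply: val_inj; rewrite /= uE zs_val_sum; apply: eq_bigr => e _.
by rewrite zs_valMz valE.
Qed.

(** On plain vectors, this is the opposite of [phi]. *)
Definition plus_chips (z : edge G -> int) : {ffun edge G -> int} :=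
  \sum_e chi (med_plus e) *~ z e.

Lemma plus_chipsD y z : plus_chips (fun e => y e + z e) = plus_chips y + plus_chips z.
Proof. by rewrite -big_split; apply: eq_bigr => e _; rewrite mulrzDr. Qed.

Lemma plus_chipsN z : plus_chips (fun e => - z e) = - plus_chips z.
Proof. by rewrite -sumrN; apply: eq_bigr => e _; rewrite mulrNz. Qed.

(** Modulo firings, the flow on [med_minus e] can be moved to [med_plus e] with the opposite sign,
    as the [chi] of the two arcs add up to a firing. *)
Lemma plus_chips_coboundary f :
  plus_chips (coboundary f) = \sum_d chi d *~ f d - \sum_e firing_vector e *~ f (med_minus e).
Proof.
rewrite sum_dart -sumrB; apply: eq_bigr => e _.
by rewrite ffunE mulrzBr mulrzDl opprD addrCA addrAC subrr add0r addrC.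
Qed.

Lemma plus_chips_lattice (z : {ffun edge G -> int}) :
  plus_chips z \in chip_lattice <-> z \in cycle_lattice G.
Proof.
split=> [/chip_latticeP[c zE]|/cycle_latticeP[f cf ->]]; last first.
  rewrite plus_chips_coboundary (circulation_chi f).1 // sub0r rpredN.
  by apply/chip_latticeP; exists (fun e => f (med_minus e)).
(* Flow [- c] on both out-arcs cancels the firings, and [z] is added on [med_plus]. *)
pose f (d : dart G) := z d.1 *+ ~~ d.2 - c d.1.
have zf : z = coboundary f by apply/ffunP => e; rewrite ffunE /f /=; ring.
apply/cycle_latticeP; exists f => //; apply/circulation_chi.
apply/eqP; rewrite -subr_eq0 subr0 -(subrK (\sum_e firing_vector e *~ f (med_minus e)) (\sum_d _)).
rewrite -plus_chips_coboundary -zf zE -big_split big1 // => e _ /=.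
by rewrite -mulrzDr /f /= sub0r subrr.
Qed.

Lemma zs_val_phi (z : {ffun edge G -> int}) : zs_val (phi z) = - plus_chips z.
Proof.
rewrite zs_val_sum -sumrN; apply: eq_bigr => e _.
by rewrite zs_valMz /= mulNrz.
Qed.

End Circulations.

(** * Tours and last exits *)

Section Tours.
Variable G : ribbon_graph.
Implicit Types (Q : {set edge G}) (t : {perm dart G}) (a b d : dart G).

Lemma oppK : involutive (@opp G).
Proof. by case=> e b; rewrite /opp /= negbK. Qed.

Lemma opp_neq d : (opp d == d) = false.
Proof. by case: d => e b; rewrite xpair_eqE eqxx; case: b. Qed.

Lemma same_src b d : (b.1 == d.1) = (b == d) || (b == opp d).
Proof.
case: b d => [e b] [e' b']; rewrite !xpair_eqE /= -andb_orr.
by case: b; case: b'; rewrite ?andbT.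
Qed.

Lemma eulerian_next t a : eulerian t -> t a = rot G a \/ t a = opp (rot G a).
Proof.
case/andP=> /forallP/(_ a); rewrite eq_sym /src /tgt same_src => /orP[]/eqP-> _; by [left|right].
Qed.

Lemma boundary_permE Q a :
  boundary_perm Q a = if (rot G a).1 \in Q then opp (rot G a) else rot G a.
Proof. by rewrite permE. Qed.

(** [boundary_perm Q] always passes from an arc to one leaving its head, so being a tour amounts to
    having a single orbit; [e0] provides that orbit. *)
Lemma eulerian_boundary_perm Q : edge G -> eulerian (boundary_perm Q) = quasi_tree Q.
Proof.
move=> e0; have srcE : [forall a : dart G, tgt a == src (boundary_perm Q a)].
  by apply/forallP => a; rewrite boundary_permE; case: ifP.
rewrite /eulerian srcE /quasi_tree; apply/forallP/cards1P => [full|[A AE] a].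
  exists setT; apply/setP => B; rewrite inE.
  apply/imsetP/eqP => [[a _ ->]|->]; first exact/eqP/full.
  by exists (e0, true); rewrite ?(eqP (full _)).
have porbitA b : porbit (boundary_perm Q) b = A.
  by apply/eqP; rewrite -in_set1 -AE; apply/imsetP; exists b.
by apply/eqP/setP => b; rewrite porbitA inE -(porbitA b) porbit_id.
Qed.

(** If one passage through a node crossed the primal edge and the other the dual one, both would
    leave by the same arc, against the injectivity of [t]. *)
Lemma bouchetP t (eul_t : eulerian t) a :
  t a = if (rot G a).1 \in bouchet t then opp (rot G a) else rot G a.
Proof.
rewrite inE; have [/existsP[b]|/existsPn none] :=
  boolP [exists b, (crossed_half b (t b)).1 == inl (rot G a).1]; last first.
  case: (eulerian_next a eul_t) => // ta.
  by have := none a; rewrite /crossed_half ta eqxx eqxx.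
rewrite /crossed_half; case: (eqVneq (t b) (rot G b)) => //= tb.
rewrite /eq_op /= => /eqP ab; have : (rot G a).1 == (rot G b).1 by rewrite ab.
rewrite same_src => /orP[/eqP/perm_inj -> //|/eqP ra].
case: (eulerian_next a eul_t) => // ta.
move: ta; rewrite ra oppK -tb => /perm_inj ab'.
by have := opp_neq (rot G b); rewrite -ra ab' eqxx.
Qed.

Lemma bouchetK t : eulerian t -> boundary_perm (bouchet t) = t.
Proof. by move=> eul_t; apply/permP => a; rewrite boundary_permE -bouchetP. Qed.

Lemma bouchet_boundary_perm Q : bouchet (boundary_perm Q) = Q.
Proof.
apply/setP => e; rewrite inE; apply/idP/idP => [|eQ].
  apply: contraR => eNQ; apply/existsP; exists ((rot G)^-1%g (e, true)).
  by rewrite /crossed_half boundary_permE permKV /= (negPf eNQ) eqxx.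
apply/existsPn => a; rewrite /crossed_half boundary_permE.
have [rQ|rNQ] := boolP ((rot G a).1 \in Q); first by rewrite opp_neq.
by rewrite eqxx /=; apply: contraNneq rNQ => -[->].
Qed.

Lemma tour_ofE Q : edge G -> quasi_tree Q -> tour_of Q = boundary_perm Q.
Proof.
move=> e0 qtQ; rewrite /tour_of; case: pickP => [t /andP[eul_t /eqP tQ]|/(_ (boundary_perm Q))].
  by rewrite -tQ bouchetK.
by rewrite eulerian_boundary_perm // qtQ bouchet_boundary_perm eqxx.
Qed.

Section Eulerian.
Variable t : {perm dart G}.
Hypothesis eul_t : eulerian t.

Let N := #|{: dart G}|.

Lemma eulerian_porbit a : porbit t a = [set: dart G].
Proof. by case/andP: eul_t => _ /forallP/(_ a)/eqP. Qed.

Lemma eulerian_card a : #|porbit t a| = N.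
Proof. by rewrite eulerian_porbit cardsT. Qed.

Lemma mem_tour a b : b \in tour_from t a.
Proof. by rewrite /tour_from -/N -(eulerian_card a) -porbit_traject eulerian_porbit inE. Qed.

Lemma uniq_tour a : uniq (tour_from t a).
Proof. by rewrite /tour_from -/N -(eulerian_card a) uniq_traject_porbit. Qed.

Lemma iter_tour a : iter N t a = a.
Proof. by rewrite -(eulerian_card a) iter_porbit. Qed.

Lemma tour_cons a : exists s,
  [/\ tour_from t a = a :: s, tour_from t (t a) = rcons s a, a \notin s
    & forall d, d != a -> d \in s].
Proof.
have [n nE] : exists n, N = n.+1.
  by exists N.-1; rewrite prednK //; apply/card_gt0P; exists a.
exists (traject t (t a) n).
have sE : tour_from t a = a :: traject t (t a) n by rewrite /tour_from -/N nE.
split=> //.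
- by rewrite /tour_from -/N nE trajectSr -iterSr -nE iter_tour.
- by have := uniq_tour a; rewrite sE => /andP[].
by move=> d da; have := mem_tour a d; rewrite sE inE (negPf da).
Qed.

Lemma tgt_tour a : tgt a = src (t a).
Proof. by case/andP: eul_t => /forallP/(_ a)/eqP. Qed.

Lemma tour_neq a : t a != a.
Proof.
apply/eqP => ta; have : opp a \in porbit t a by rewrite eulerian_porbit inE.
by case/porbitP => n; rewrite (permX_fix n ta) => oa; have := opp_neq a; rewrite oa eqxx.
Qed.

End Eulerian.

(** At the root, where the last out-arc traversed is [opp a], the rotor is [a]. *)
Definition last_exit t a d : bool :=
  if d.1 == a.1 then d == a
  else (index (opp d) (tour_from t a) < index d (tour_from t a))%N.

Lemma index_opp_neq t a d : eulerian t ->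
  index (opp d) (tour_from t a) != index d (tour_from t a).
Proof.
move=> eul_t; apply/eqP => eq_i.
have := nth_index d (mem_tour eul_t a (opp d)); rewrite eq_i nth_index ?mem_tour //.
by move/eqP; rewrite eq_sym opp_neq.
Qed.

Lemma mem_rotor t a d : eulerian t -> (d \in a |: arborescence t a) = last_exit t a d.
Proof.
move=> eul_t; rewrite !inE /last_exit /src.
have [->|da] := eqVneq d a; first by rewrite eqxx.
case: eqP => //= _; apply/forallP/idP => [/(_ (opp d))|lt c].
  by rewrite eqxx /= leq_eqVlt (negPf (index_opp_neq _ _ eul_t)).
by apply/implyP; rewrite same_src => /orP[]/eqP->//; apply: ltnW.
Qed.

Lemma last_exit_opp t a d : eulerian t -> last_exit t a (opp d) = ~~ last_exit t a d.
Proof.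
move=> eul_t; rewrite /last_exit oppK /=; case: ifP => [|_].
  rewrite same_src => /orP[]/eqP ->; rewrite ?eqxx ?oppK ?opp_neq ?eqxx //.
have := index_opp_neq a d eul_t; lia.
Qed.

(** Starting one arc later moves [a] from front to back and keeps the order of the others. At the
    node of [a] the last exit becomes [a], which the root convention had already made its rotor. *)
Lemma last_exit_next t a d : eulerian t ->
  last_exit t (t a) d = if d.1 == (t a).1 then d == t a else last_exit t a d.
Proof.
move=> eul_t; rewrite /last_exit; case: ifP => // d_ta.
have [s [-> -> asN ins]] := tour_cons eul_t a.
have idx b : b != a -> (index b (rcons s a) = index b s) * (index b (a :: s) = (index b s).+1).
  by move=> ba; rewrite -cats1 index_cat ins //= eq_sym (negPf ba).
have idxa : index a (rcons s a) = size s.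
  by rewrite -cats1 index_cat (negPf asN) /= eqxx addn0.
have [|da] := boolP (d.1 == a.1).
  rewrite same_src => /orP[]/eqP->.
    rewrite eqxx idxa idx ?opp_neq // index_mem ins ?opp_neq //.
  by rewrite opp_neq oppK idxa idx ?opp_neq // ltnNge ltnW // index_mem ins ?opp_neq.
have dNa : d != a by apply: contraNneq da => ->.
have odNa : opp d != a by apply: contraNneq da => <-.
by rewrite !idx.
Qed.

Lemma last_exit_second t a : eulerian t -> last_exit t a (t a) = false.
Proof.
move=> eul_t; rewrite /last_exit; case: ifP => [_|]; first by rewrite (negPf (tour_neq eul_t a)).
have := mem_tour eul_t a (t a).
rewrite /tour_from; have [n ->] : exists n, #|{: dart G}| = n.+2.
  exists #|{: dart G}|.-2; have : (1 < #|{: dart G}|)%N.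
    by apply/card_gt1P; exists a, (opp a); rewrite eq_sym opp_neq.
  by lia.
move=> _ ta; rewrite /= eqxx; have := tour_neq eul_t a; rewrite eq_sym => /negPf ->.
by case: eqP => [ata|_]; [rewrite {2}ata eqxx in ta | rewrite eq_sym opp_neq].
Qed.

End Tours.

(** * Tours are determined by their last exits modulo signed cycles *)

Section Uniqueness.
Variable G : ribbon_graph.
Implicit Types (t : {perm dart G}) (a b d : dart G).

Lemma index_tour_next t a d : eulerian t -> t d != a ->
  index (t d) (tour_from t a) = (index d (tour_from t a)).+1.
Proof.
move=> eul_t tda; set N := #|{: dart G}|; set i := index d _.
have iN : (i < N)%N by rewrite -[N](size_traject t a) index_mem mem_tour.
have dE : d = iter i t a by rewrite -(nth_traject t iN) nth_index ?mem_tour.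
have iN' : (i.+1 < N)%N.
  rewrite ltn_neqAle iN andbT; apply: contraNneq tda => iE.
  by rewrite dE -iterS iE iter_tour.
rewrite {1}dE -iterS -(nth_traject t iN' a) index_uniq ?size_traject //.
exact: uniq_tour.
Qed.

(** Last exits lead to the root: let [d] be the latest last exit leaving [Z]. If the root were
    outside [Z], the next arc [t d] would start in [Z], and the last exit of its node would come
    even later. *)
Lemma last_exit_root_closed t a (Z : {set edge G}) : eulerian t -> Z != set0 ->
  (forall d, src d \in Z -> last_exit t a d -> tgt d \in Z) -> src a \in Z.
Proof.
move=> eul_t /set0Pn[n nZ] closedZ; apply: contraT => aZ.
have pick_exit d : exists2 d', src d' = src d & last_exit t a d'.
  case dl : (last_exit t a d); first by exists d.
  by exists (opp d); rewrite ?last_exit_opp ?dl.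
have [d0 d0n d0l] := pick_exit (n, true).
pose P d := (src d \in Z) && last_exit t a d.
have P0 : P d0 by rewrite /P d0n nZ.
case: (arg_maxnP (fun d => index d (tour_from t a)) P0) => d /andP[dZ dl] dmax.
have tdZ := closedZ d dZ dl; rewrite (tgt_tour eul_t) in tdZ.
have td_a : t d != a by apply: contraNneq aZ => <-.
have [d' d'td d'l] := pick_exit (t d).
have := dmax d'; rewrite /P d'td tdZ d'l => /(_ isT) /=.
apply: contraTT => _; rewrite -ltnNge.
have lt_td : (index d (tour_from t a) < index (t d) (tour_from t a))%N.
  by rewrite index_tour_next.
apply: leq_trans lt_td _.
move/eqP: (d'td); rewrite /src same_src => /orP[]/eqP d'E; first by rewrite d'E.
have d'a : (d'.1 == a.1) = false.
  by apply/negP => /eqP d'a; move: aZ; rewrite /src -d'a -/(src d') d'td tdZ.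
by move: d'l; rewrite /last_exit d'a d'E oppK; apply: ltnW.
Qed.

(** An arc carrying the maximal flow [m] ends at a node which also has an out-arc
    carrying [m], by conservation of flow and because the two flows out of a node
    differ by at most 1.  Following last exits along such arcs leads to the root. *)
Lemma circulation_max t a (f : dart G -> int) : eulerian t -> circulation f ->
  (forall d, last_exit t a d -> 0 <= f d - f (opp d) <= 1) -> forall b, f b <= f a.
Proof.
move=> eul_t cf near.
have [b0 _ maxf] := Order.TotalTheory.arg_maxP f (erefl : xpredT a).
pose m := f b0; have le_m b : f b <= m by exact: maxf.
pose g d : int := (f d == m)%:R.
have near_out d : `|f d - f (opp d)| <= 1.
  case dl : (last_exit t a d); first by have := near d dl; lia.
  have := near (opp d); rewrite last_exit_opp // dl oppK => /(_ isT); lia.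
(* With one maximal out-arc the other carries at least [m - 1], so some in-arc carries [m]; with
   two, both in-arcs do. So maximal in-arcs are at least as many as maximal out-arcs, and summing
   over the nodes gives equality. *)
have flow_ge0 n : 0 <= \sum_(d | tgt d == n) g d - \sum_(d | src d == n) g d.
  rewrite sum_in_arcs sum_out_arcs /g; have := cf n; have := near_out (n, true).
  rewrite /opp /=; set p := (rot G)^-1%g _; set q := (rot G)^-1%g _.
  have := le_m p; have := le_m q; have := le_m (n, true); have := le_m (n, false).
  by case: eqP; case: eqP; case: eqP; case: eqP => /=; lia.
have flow0 n : \sum_(d | tgt d == n) g d = \sum_(d | src d == n) g d.
  have : \sum_n (\sum_(d | tgt d == n) g d - \sum_(d | src d == n) g d) == 0.
    have part (h : dart G -> edge G) : \sum_n \sum_(d | h d == n) g d = \sum_d g d.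
      by rewrite [RHS](partition_big h xpredT).
    by rewrite sumrB !part subrr.
  rewrite psumr_eq0 // => /allP/(_ n); rewrite mem_index_enum subr_eq0.
  by move=> /(_ isT)/eqP.
pose Z := [set n | [exists d, (src d == n) && (f d == m)]].
have memZ d : f d = m -> src d \in Z.
  by move=> fd; rewrite inE; apply/existsP; exists d; rewrite fd !eqxx.
have exitZ d : src d \in Z -> last_exit t a d -> f d = m.
  rewrite inE => /existsP[d' /andP[d'd /eqP fd']] dl; move: d'd.
  rewrite /src same_src => /orP[]/eqP d'E; first by rewrite -d'E.
  by have := near d dl; rewrite -d'E fd'; have := le_m d; lia.
have aZ : src a \in Z.
  apply: (last_exit_root_closed eul_t); first by apply/set0Pn; exists (src b0); apply: memZ.
  move=> d dZ dl; have fd := exitZ d dZ dl.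
  have : 0 < \sum_(d' | tgt d' == tgt d) g d'.
    by rewrite (bigD1 d) //= /g fd eqxx ltr_pwDl // sumr_ge0.
  rewrite flow0; apply: contraTT => dNZ; rewrite -leNgt big1 // => d' /eqP d'd.
  by rewrite /g; case: eqP => // /memZ; rewrite d'd (negPf dNZ).
by move=> b; rewrite (exitZ a aZ) // /last_exit !eqxx.
Qed.

Definition exit_vector t a : {ffun edge G -> int} :=
  [ffun e => (last_exit t a (med_plus e))%:R].

Lemma last_exit_minus t a e : eulerian t ->
  last_exit t a (e, true) = ~~ last_exit t a (e, false).
Proof. by move=> eul_t; rewrite -last_exit_opp. Qed.

(** Write the difference as the coboundary of [f]. The last exits of [t'] satisfy the hypothesis of
    [circulation_max] for [f], those of [t] for its opposite; so [f] has its maximum and its minimum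
    at [a] and is constant. *)
Lemma last_exit_cycle_lattice t t' a : eulerian t -> eulerian t' ->
  exit_vector t' a - exit_vector t a \in cycle_lattice G ->
  last_exit t a =1 last_exit t' a.
Proof.
move=> eul_t eul_t' /cycle_latticeP[f cf fE].
have fEe e : f (e, false) - f (e, true) =
    (last_exit t' a (e, false))%:R - (last_exit t a (e, false))%:R.
  by have /ffunP/(_ e) := fE; rewrite !ffunE.
have max_f : forall b, f b <= f a.
  apply: (circulation_max eul_t' cf) => -[e []]; have := fEe e; rewrite ?last_exit_minus //.
    by case: (last_exit t' a _); case: (last_exit t a _) => //=; rewrite /opp /=; lia.
  by case: (last_exit t' a _); case: (last_exit t a _) => //=; rewrite /opp /=; lia.
have min_f : forall b, - f b <= - f a.
  apply: (circulation_max eul_t (f := fun d => - f d)); first by move=> e; have := cf e; lia.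
  move=> -[e []]; have := fEe e; rewrite ?last_exit_minus //.
    by case: (last_exit t' a _); case: (last_exit t a _) => //=; rewrite /opp /=; lia.
  by case: (last_exit t' a _); case: (last_exit t a _) => //=; rewrite /opp /=; lia.
have eq_plus e : last_exit t a (e, false) = last_exit t' a (e, false).
  have := fEe e; have := max_f (e, false); have := min_f (e, false).
  have := max_f (e, true); have := min_f (e, true).
  by case: (last_exit t a _); case: (last_exit t' a _) => //=; lia.
by case=> e []; rewrite ?last_exit_minus // eq_plus.
Qed.

(** Away from the root, a tour first leaves a node along the arc that is not the last exit; at the
    root, [a] is already in [p]. This rule lets the rotors determine the tour. *)
Lemma next_exit t a i (p := traject t a i.+1) (d := iter i.+1 t a) :
  eulerian t -> (i.+1 < #|{: dart G}|)%N ->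
  (d \notin p) && ((opp d \in p) || ~~ last_exit t a d).
Proof.
move=> eul_t iN; have [k Nk] : exists k, #|{: dart G}| = (i.+2 + k)%N.
  by exists (#|{: dart G}| - i.+2)%N; rewrite subnKC.
have tourE : tour_from t a = rcons p d ++ traject t (iter i.+2 t a) k.
  by rewrite /tour_from Nk trajectD trajectSr.
have := uniq_tour eul_t a; rewrite tourE cat_uniq rcons_uniq => /andP[/andP[dp _] _].
rewrite dp /=; have [//|odp] := boolP (opp d \in p); rewrite /last_exit.
case: ifP => [_|_]; first by apply: contraNneq dp => ->; rewrite inE eqxx.
rewrite -leqNgt tourE -cats1 -catA !index_cat (negPf dp) (negPf odp) leq_add2l /=.
by rewrite inE !eqxx.
Qed.

Lemma eulerian_eq t t' a : eulerian t -> eulerian t' ->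
  last_exit t a =1 last_exit t' a -> t = t'.
Proof.
move=> eul_t eul_t' eq_l; set N := #|{: dart G}|.
have eq_traject i : (i < N)%N -> traject t a i.+1 = traject t' a i.+1.
  elim: i => [//|i IHi] iN; rewrite 2!(trajectSr _ _ i.+1) IHi ?(ltnW iN) //.
  congr (rcons _ _).
  have := next_exit a eul_t iN; have := next_exit a eul_t' iN; rewrite IHi ?(ltnW iN) //.
  have iterE : iter i t a = iter i t' a.
    by have := congr1 (last a) (IHi (ltnW iN)); rewrite !trajectSr !last_rcons.
  have : src (iter i.+1 t a) == src (iter i.+1 t' a).
    by rewrite !iterS iterE -(tgt_tour eul_t) -(tgt_tour eul_t').
  rewrite /src same_src => /orP[/eqP //|/eqP ->]; rewrite oppK eq_l last_exit_opp //.
  by case: (opp _ \in _); case: (_ \in _); case: (last_exit _ _ _).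
have eq_iter i : (i < N)%N -> iter i t a = iter i t' a.
  move=> /eq_traject eq_i; have := congr1 (last a) eq_i.
  by rewrite !trajectSr !last_rcons.
apply/permP => x; have /trajectP[i iN ->] := mem_tour eul_t a x.
rewrite {2}eq_iter // -!iterS; have [iN'|] := ltnP i.+1 N; first exact: eq_iter.
move=> Ni; have -> : i.+1 = N by apply/eqP; rewrite eqn_leq iN Ni.
by rewrite !iter_tour.
Qed.

End Uniqueness.

Lemma eq_mem_pred (T : Type) (P : {pred T}) x y : x \in P -> x = y -> y \in P.
Proof. by move=> xP <-. Qed.

(** * Change of the starting arc of a tour *)

Section RootChange.
Variable G : ribbon_graph.
Implicit Types (t : {perm dart G}) (a b d : dart G).

Lemma plus_chips_single (e : edge G) k :
  plus_chips (fun e' => k *+ (e' == e)) = chi (med_plus e) *~ k.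
Proof.
rewrite /plus_chips (bigD1 e) //= eqxx big1 ?addr0 // => e' /negPf ->.
by rewrite mulr0n mulr0z.
Qed.

Lemma eq_plus_chips (y z : edge G -> int) : y =1 z -> plus_chips y = plus_chips z.
Proof. by move=> yz; apply: eq_bigr => e _; rewrite yz. Qed.

Lemma plus_chipsB (y z : edge G -> int) :
  plus_chips y - plus_chips z = plus_chips (fun e => y e - z e).
Proof. by rewrite plus_chipsD plus_chipsN. Qed.

Definition unit_chip (e : edge G) : {ffun edge G -> int} := [ffun n => (n == e)%:R].

Lemma chiE d : chi d = unit_chip (tgt d) - unit_chip (src d).
Proof. by apply/ffunP => n; rewrite !ffunE. Qed.

(** Only the rotor at the node of [t a] changes, from [opp (t a)] to [t a]. If [t a] is [med_plus],
    this contributes exactly [chi (t a)]; if it is [med_minus], the discrepancy is the opposite of a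
    firing. *)
Lemma exit_vector_next t a : eulerian t ->
  plus_chips (exit_vector t (t a)) - plus_chips (exit_vector t a) - chi (t a)
    \in chip_lattice G.
Proof.
move=> eul_t; rewrite plus_chipsB.
set e := (t a).1; set s : int := if (t a).2 then -1 else 1.
rewrite (@eq_plus_chips _ (fun e' => s *+ (e' == e))) => [|e'].
  rewrite plus_chips_single /s /e; case: (t a) => n [] /=; last by rewrite subrr rpred0.
  rewrite mulrNz mulr1z -opprD rpredN; exact: (firing_vector_lattice n).
rewrite !ffunE last_exit_next //= -/e; have [->|_] := eqVneq e' e; last by rewrite subrr.
have := last_exit_second a eul_t; rewrite /s /e; case: (t a) => n [].
  by rewrite last_exit_minus // => /negbFE ->; rewrite xpair_eqE andbF.
by rewrite /= => ->; rewrite eqxx.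
Qed.

(** Up to firings, [plus_chips (exit_vector t a) - unit_chip (tgt a)] does not
    depend on [a]. *)
Lemma exit_vector_root t t' a b : eulerian t -> eulerian t' ->
  (plus_chips (exit_vector t b) - plus_chips (exit_vector t' b)) -
  (plus_chips (exit_vector t a) - plus_chips (exit_vector t' a)) \in chip_lattice G.
Proof.
have potential u i : eulerian u ->
    (plus_chips (exit_vector u (iter i u a)) - unit_chip (tgt (iter i u a))) -
    (plus_chips (exit_vector u a) - unit_chip (tgt a)) \in chip_lattice G.
  move=> eul_u; elim: i => [|i IHi]; first by rewrite subrr rpred0.
  apply: eq_mem_pred (rpredD (exit_vector_next (iter i u a) eul_u) IHi) _.
  rewrite chiE -iterS -(tgt_tour eul_u).
  by apply/ffunP => n; rewrite !ffunE; ring.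
move=> eul_t eul_t'.
have root u : eulerian u ->
    (plus_chips (exit_vector u b) - unit_chip (tgt b)) -
    (plus_chips (exit_vector u a) - unit_chip (tgt a)) \in chip_lattice G.
  by move=> eul_u; have /trajectP[i _ ->] := mem_tour eul_u a b; apply: potential.
apply: eq_mem_pred (rpredB (root _ eul_t) (root _ eul_t')) _.
by apply/ffunP => n; rewrite !ffunE; ring.
Qed.

End RootChange.

(** * Rotor routing *)

Section Rotor.
Variable G : ribbon_graph.
Implicit Types (t : {perm dart G}) (a b d : dart G) (rho : {set dart G}).
Implicit Types x y u : {ffun edge G -> int}.

Notation reach := (clos_refl_trans _ (@routing G)).

Definition rotors rho := forall d, (opp d \in rho) = (d \notin rho).

Definition plus_rotors rho : {ffun edge G -> int} := [ffun e => (med_plus e \in rho)%:R].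

(** Modulo firings, this is the complete invariant of reachability by routings ([reachP]). *)
Definition charge (c : {ffun edge G -> int} * {set dart G}) :=
  c.1 - plus_chips (plus_rotors c.2).

Lemma rotors_switch rho a : rotors rho -> a \in rho -> rotors (opp a |: (rho :\ a)).
Proof.
move=> rhoP arho d; rewrite !inE rhoP (inv_eq (@oppK G)) oppK (inv_eq (@oppK G)).
have [->|da] := eqVneq d a; first by rewrite arho /= eq_sym opp_neq.
by have [->|dna] := eqVneq d (opp a); rewrite ?rhoP ?arho //= negb_or.
Qed.

(** Switching a rotor to [med_plus] adds the same vector to both terms of the charge; switching away
    from it adds the [chi] of both out-arcs, a firing. *)
Lemma routing_charge c c' : routing c c' -> rotors c.2 ->
  rotors c'.2 /\ charge c' - charge c \in chip_lattice G.
Proof.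
case=> x rho a arho /= rhoP; split; first exact: rotors_switch.
set rho' := opp a |: _.
have -> : charge (x + chi (opp a), rho') - charge (x, rho) =
    chi (opp a) - (plus_chips (plus_rotors rho') - plus_chips (plus_rotors rho)).
  by rewrite /charge /=; apply/ffunP => n; rewrite !ffunE; ring.
rewrite plus_chipsB; set s : int := if a.2 then 1 else -1.
rewrite (@eq_plus_chips _ _ (fun e' => s *+ (e' == a.1))) => [|e'].
  rewrite plus_chips_single /s; case: (a) => n [] /=; first by rewrite subrr rpred0.
  by rewrite mulrNz mulr1z opprK addrC; exact: (firing_vector_lattice n).
rewrite !ffunE !inE /s; case: (a) arho rhoP => n [] arho rhoP; rewrite !xpair_eqE /= ?andbT ?andbF.
  have [->|//] := eqVneq e' n; last by rewrite /= subrr.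
  by have := rhoP (n, false); rewrite /opp /= arho => /esym /negbTE ->.
have [->|//] := eqVneq e' n; last by rewrite /= subrr.
by rewrite arho.
Qed.

Lemma reach_charge c c' : reach c c' -> rotors c.2 ->
  rotors c'.2 /\ charge c' - charge c \in chip_lattice G.
Proof.
elim=> {c c'} [c c'|c|c c' c'' _ IH1 _ IH2] rhoP.
- exact: routing_charge.
- by rewrite subrr rpred0.
have [rhoP' h1] := IH1 rhoP; have [rhoP'' h2] := IH2 rhoP'; split=> //.
apply: eq_mem_pred (rpredD h2 h1) _; by rewrite addrA subrK.
Qed.

(** Two routings at the same node send a chip along each out-arc and restore the rotor. *)
Lemma reach_firing x rho e : rotors rho -> reach (x, rho) (x + firing_vector e, rho).
Proof.
move=> rhoP; have [a ae arho] : exists2 a, a.1 = e & a \in rho.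
  case er : ((e, true) \in rho); first by exists (e, true).
  by exists (e, false); rewrite // (rhoP (e, true)) er.
apply: rt_trans (rt_step _ _ _ _ (Routing x arho)) _.
have oarho : opp a \in opp a |: rho :\ a by rewrite !inE eqxx.
have := Routing (x + chi (opp a)) oarho; rewrite oppK.
have -> : a |: ((opp a |: rho :\ a) :\ opp a) = rho.
  apply/setP => d; rewrite !inE; have [->|da] := eqVneq d a; first by rewrite arho.
  by have [->|_] //= := eqVneq d (opp a); rewrite rhoP arho.
have -> : x + chi (opp a) + chi a = x + firing_vector e.
  by rewrite -addrA -ae; case: (a) => n []; rewrite // [chi _ + _]addrC.
exact: rt_step.
Qed.

Lemma sum_firing : \sum_e firing_vector e = 0 :> {ffun edge G -> int}.
Proof.
have := (circulation_chi (fun _ : dart G => 1)).1 (fun e => erefl).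
by rewrite sum_dart => sum0; rewrite -[RHS]sum0; apply: eq_bigr => e _; rewrite !mulr1z addrC.
Qed.

Lemma reach_lattice x u rho : rotors rho -> u \in chip_lattice G ->
  reach (x, rho) (x + u, rho).
Proof.
move=> rhoP /chip_latticeP[c ->].
(* Routings can only add firings, so the coefficients are made nonnegative by adding [M] times the
   sum of all firings, which vanishes. *)
pose M := \sum_e `|c e|; pose k e := absz (c e + M).
have -> : \sum_e firing_vector e *~ c e = \sum_e firing_vector e *+ k e.
  have firingM : \sum_e firing_vector e *~ M = 0 :> {ffun edge G -> int}.
    by rewrite -mulrz_suml sum_firing mul0rz.
  rewrite -[LHS]addr0 -[X in _ + X]firingM -big_split.
  apply: eq_bigr => e _ /=; rewrite -mulrzDr pmulrn /k gez0_abs //.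
  have : `|c e| <= M by rewrite /M (bigD1 e) //= lerDl sumr_ge0.
  lia.
elim: (index_enum _) x => [|e r IHr] x; first by rewrite big_nil addr0; apply: rt_refl.
rewrite big_cons addrA; apply: rt_trans (IHr _).
elim: (k e) => [|n IHn]; first by rewrite mulr0n addr0; apply: rt_refl.
by apply: rt_trans IHn _; rewrite mulrSr addrA; apply: reach_firing.
Qed.

Lemma reach_rotors x rho rho' : rotors rho -> rotors rho' ->
  exists y, reach (x, rho) (y, rho').
Proof.
have [n] := ubnP #|rho :\: rho'|; elim: n x rho => // n IHn x rho /ltnSE le_n rhoP rhoP'.
have [|/set0Pn[a]] := eqVneq (rho :\: rho') set0.
  move/eqP; rewrite setD_eq0 => /subsetP sub; exists x.
  suff -> : rho = rho' by apply: rt_refl.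
  apply/setP => d; apply/idP/idP => [/sub //|drho'].
  apply: contraT => /[dup] drho; rewrite -rhoP => /sub.
  by rewrite rhoP' drho'.
rewrite !inE => /andP[arho' arho].
have [|y hy] := IHn (x + chi (opp a)) (opp a |: rho :\ a) _ (rotors_switch rhoP arho) rhoP'.
  apply: leq_trans le_n; apply: proper_card; apply/properP; split.
    apply/subsetP => d; rewrite !inE => /andP[drho' /orP[/eqP dE|/andP[_ ->]]].
      by move: drho'; rewrite dE rhoP' (negPf arho').
    by rewrite drho'.
  exists a; rewrite !inE ?arho ?arho' //= eqxx /= orbF eq_sym opp_neq //.
by exists y; apply: rt_trans hy; apply: rt_step; apply: Routing.
Qed.

(** Routing first makes the rotors agree; by invariance of the charge the remaining chips differ by
    firings, which [reach_lattice] realises. *)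
Lemma reachP c c' : rotors c.2 -> rotors c'.2 ->
  reach c c' <-> charge c' - charge c \in chip_lattice G.
Proof.
move=> rhoP rhoP'; split=> [/reach_charge/(_ rhoP)[] //|].
case: c c' rhoP rhoP' => x rho [y rho'] /= rhoP rhoP' hc.
have [z hz] := reach_rotors x rhoP rhoP'; have [_ hz'] := reach_charge hz rhoP.
apply: rt_trans hz _.
rewrite -[y](subrK z) addrC; apply: reach_lattice => //.
apply: eq_mem_pred (rpredB hc hz') _.
by rewrite /charge /=; apply/ffunP => e; rewrite !ffunE; ring.
Qed.

Lemma tour_rotors t a : eulerian t -> rotors (a |: arborescence t a).
Proof. by move=> eul_t d; rewrite !mem_rotor // last_exit_opp. Qed.

Lemma tour_plus_rotors t a : eulerian t ->
  plus_rotors (a |: arborescence t a) = exit_vector t a.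
Proof. by move=> eul_t; apply/ffunP => e; rewrite !ffunE mem_rotor. Qed.

Lemma repr_pi_sandpile (u : zs_vector G) :
  repr (\pi_(sandpile G)%qT u) - u \in firing_lattice G.
Proof. by rewrite Quotient.idealrBE reprK. Qed.

(** The charge subtracts the rotors and [phi] carries a minus sign, so [z] and the exit vector of
    [t] add up. By [exit_vector_root], the starting arc chosen in [tour_rotor_rel] can be replaced
    by [a]. *)
Lemma tour_rotor_relP (z : {ffun edge G -> int}) t t' (a : dart G) :
  eulerian t -> eulerian t' ->
  tour_rotor_rel (\pi_(sandpile G)%qT (phi z)) t t' <->
  z + exit_vector t a - exit_vector t' a \in cycle_lattice G.
Proof.
move=> eul_t eul_t'; rewrite -plus_chips_lattice.
set x := zs_val (repr (\pi_(sandpile G)%qT (phi z))).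
have xz : x + plus_chips z \in chip_lattice G.
  have := repr_pi_sandpile (phi z); rewrite firing_latticeP.
  by move=> h; apply: eq_mem_pred h _; rewrite -[plus_chips z]opprK -zs_val_phi.
have plusE : plus_chips (z + exit_vector t a - exit_vector t' a) =
    plus_chips z + (plus_chips (exit_vector t a) - plus_chips (exit_vector t' a)).
  rewrite plus_chipsB -plus_chipsD; apply: eq_plus_chips => e; rewrite !ffunE; ring.
have relP b : reach (x, b |: arborescence t b) (0, b |: arborescence t' b) <->
    plus_chips (z + exit_vector t a - exit_vector t' a) \in chip_lattice G.
  apply: iff_trans (reachP (c := (_, _)) (c' := (_, _)) _ _) _; try exact: tour_rotors.
  have rootab := exit_vector_root a b eul_t eul_t'.
  rewrite plusE /charge /= !tour_plus_rotors //; split=> h.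
    apply: eq_mem_pred (rpredB (rpredD h xz) rootab) _.
    by apply/ffunP => e; rewrite !ffunE; ring.
  apply: eq_mem_pred (rpredB (rpredD h rootab) xz) _.
  by apply/ffunP => e; rewrite !ffunE; ring.
by split=> [[b /relP]|h] //; exists a; apply/relP.
Qed.

End Rotor.

(** * Bernardi orientations *)

Section Bernardi.
Variables (G : ribbon_graph) (e0 : edge G).
Implicit Types (Q : {set edge G}).

Let a0 : dart G := med_plus e0.

(** The half-edge crossed just before leaving along [d]. *)
Definition entry_half Q (d : dart G) : half G :=
  if d.1 \in Q then dual (~~ d.2) d.1 else primal d.2 d.1.

Lemma entry_half_inj Q : injective (entry_half Q).
Proof.
move=> [e b] [e' b']; rewrite /entry_half /=.
case: (e \in Q); case: (e' \in Q) => // -[->].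
  by move/negb_inj ->.
by move->.
Qed.

Lemma crossed_half_entry Q b :
  crossed_half b (boundary_perm Q b) = entry_half Q (boundary_perm Q b).
Proof.
rewrite /crossed_half /entry_half boundary_permE.
case: (boolP ((rot G b).1 \in Q)) => rQ; first by rewrite opp_neq /= rQ negbK.
by rewrite eqxx (negPf rQ).
Qed.

(** The passage into [a0] crosses whichever of primal^-([e0]) and dual^+([e0]) is crossed at all.
    [crossings] lists it last, as it starts with the passage out of [a0]; the rotation brings it to
    the front. *)
Lemma crossing_orderE Q : quasi_tree Q ->
  crossing_order e0 Q = [seq entry_half Q d | d <- tour_from (boundary_perm Q) a0].
Proof.
move=> qtQ; rewrite /crossing_order /crossings (tour_ofE e0 qtQ).
set t := boundary_perm Q.
have eul_t : eulerian t by rewrite eulerian_boundary_perm.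
have [s [ta0 tta0 a0Ns _]] := tour_cons eul_t a0.
have -> : [seq crossed_half b (t b) | b <- tour_from t a0] =
          [seq entry_half Q d | d <- s] ++ [:: entry_half Q a0].
  rewrite (eq_map (crossed_half_entry Q)) (map_comp (entry_half Q) t) cats1.
  rewrite -map_rcons -tta0 /tour_from.
  by elim: #|_| (a0) => [//|n IHn] a /=; rewrite IHn.
set p := pred2 _ _; have first_half d : p (entry_half Q d) = (d == a0).
  case: d => e b; rewrite /p /entry_half /= !xpair_eqE /a0 /=.
  by case: (boolP (e \in Q)) => eQ; rewrite /= !xpair_eqE ?eqxx; case: b;
    rewrite ?andbT ?andbF ?orbF.
rewrite find_cat has_map.
have -> : has (preim (entry_half Q) p) s = false.
  apply/negP => /hasP[d ds pd]; have : d == a0 by rewrite -first_half.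
  by move/eqP => da; rewrite -da ds in a0Ns.
have -> : find p [:: entry_half Q a0] = 0%N.
  by rewrite -[find _ _]/(if p (entry_half Q a0) then 0 else 1)%N first_half eqxx.
by rewrite addn0 rot_size_cat ta0.
Qed.

(** The crossed halves at v_e are the entry halves of its two out-arcs, so the sign is positive when
    [med_minus e] is traversed before [med_plus e]. At [e0] the root convention makes [exit_vector]
    1 although [a0] comes first, hence the correction. *)
Lemma bernardi_orientationE Q e : quasi_tree Q ->
  bernardi_orientation e0 Q e = (exit_vector (boundary_perm Q) a0 e - (e == e0)%:R)%:~R - 1 / 2%:R.
Proof.
move=> qtQ; set t := boundary_perm Q.
have eul_t : eulerian t by rewrite eulerian_boundary_perm.
have beforeE d d' : crossed_before e0 Q (entry_half Q d) (entry_half Q d') =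
    (index d (tour_from t a0) < index d' (tour_from t a0))%N.
  by rewrite /crossed_before crossing_orderE // !index_map //; apply: entry_half_inj.
rewrite !ffunE; set before := (_ || _).
have -> : before = (index (e, true) (tour_from t a0) < index (e, false) (tour_from t a0))%N.
  rewrite -beforeE /before /entry_half /=.
  by case: (e \in Q); rewrite /= ?orbF.
rewrite /last_exit /=; have [->|ne] := eqVneq e e0.
  by have [s [-> _ _ _]] := tour_cons eul_t a0; rewrite /= eqxx ltn0 subrr sub0r.
by rewrite subr0; case: ltnP.
Qed.

Lemma moves_classP (v : Jac G) Q Q' : quasi_tree Q -> quasi_tree Q' ->
  moves_class v (bernardi_orientation e0 Q) (bernardi_orientation e0 Q') <->
  repr v + exit_vector (boundary_perm Q) a0 - exit_vector (boundary_perm Q') a0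
    \in cycle_lattice G.
Proof.
move=> qtQ qtQ'; set z := repr v + _ - _.
have zE : [ffun e => (repr v e)%:Q] + bernardi_orientation e0 Q - bernardi_orientation e0 Q' =
    [ffun e => (z e)%:Q].
  apply/ffunP => e; rewrite /z.
  have := bernardi_orientationE e qtQ; have := bernardi_orientationE e qtQ'.
  move: (bernardi_orientation e0 Q) (bernardi_orientation e0 Q')
    (exit_vector _ _) (exit_vector _ _).
  by move=> O O' E E' OE OE'; rewrite !ffunE OE OE' !(rmorphB, rmorphD) /=; ring.
split=> [[y yL]|zL]; last by exists z.
rewrite zE => /ffunP yz; suff -> : z = y by [].
by apply/ffunP => e; have := yz e; rewrite !ffunE => /intr_inj.
Qed.

End Bernardi.

(** * Agreement of the Bernardi and tour-rotor actions *)

Theorem theorem5p11 (G : ribbon_graph) (e0 : edge G) (v : Jac G)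
    (Q : {set edge G}) :
  quasi_tree Q ->
  tour_rotor (phibar v) (tour_of Q) = tour_of (bernardi e0 v Q).
Proof.
move=> qtQ; rewrite (tour_ofE e0 qtQ).
set t := boundary_perm Q; set a0 := med_plus e0.
have eul (Q' : {set edge G}) : quasi_tree Q' -> eulerian (boundary_perm Q').
  by rewrite (eulerian_boundary_perm _ e0).
have relP (t' : {perm dart G}) : eulerian t' -> tour_rotor_rel (phibar v) t t' <->
    repr v + exit_vector t a0 - exit_vector t' a0 \in cycle_lattice G.
  by move=> eul_t'; apply: tour_rotor_relP => //; apply: eul.
have moveP (Q' : {set edge G}) : quasi_tree Q' ->
    moves_class v (bernardi_orientation e0 Q) (bernardi_orientation e0 Q') <->
    tour_rotor_rel (phibar v) t (boundary_perm Q').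
  move=> qtQ'; apply: iff_trans (moves_classP e0 v qtQ qtQ') _.
  by apply: iff_sym; apply: relP; apply: eul.
(* By [moveP] the two selections succeed together, along Bouchet's bijection; if both fail, the
   defaults [t] and [Q] correspond. *)
rewrite /tour_rotor /bernardi; case: pickP => [t' /andP[eul_t' /asboolP rel_t']|no_t'] /=.
  have qt' : quasi_tree (bouchet t') by rewrite -eulerian_boundary_perm // bouchetK.
  case: pickP => [Q' /andP[qtQ' /asboolP/(moveP _ qtQ')] rel_Q'|/(_ (bouchet t'))] /=; last first.
    by rewrite qt' => /asboolP[]; apply/moveP; rewrite ?bouchetK.
  (* Both tours are related to [t] by [v], so their exit vectors differ by an element of the cycle
     lattice. *)
  rewrite (tour_ofE e0 qtQ'); apply: (@eulerian_eq _ _ _ a0) => //; first exact: eul.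
  apply: last_exit_cycle_lattice => //; first exact: eul.
  move: rel_Q' rel_t'; rewrite !relP //; last exact: eul.
  move=> h h'; apply: eq_mem_pred (rpredB h' h) _.
  by apply/ffunP => e; rewrite !ffunE; ring.
case: pickP => [Q' /andP[qtQ' /asboolP/(moveP _ qtQ') rel_Q']|_] /=.
  by have := no_t' (boundary_perm Q'); rewrite eul //= => /asboolP[].
by rewrite (tour_ofE e0 qtQ).
Qed.
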